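(* Let $M=\{v,d_{(a,k)}\}\in\mathcal{M}_1$ be a feasible menu of stop-loss policies. Then (i) for any $k\in K$, $$v'_-(a)\le \mathbf{1}_{\{a>d_{(a,k)}\}}\le\mathbf{1}_{\{a\ge d_{(a,k)}\}}\le v'_+(a)\quad\text{for all }a>0,$$ and $$\mathbf{1}_{\{0\ge d_{(0,k)}\}}\le v'_+(0);$$ (ii) the function $v$ must take the form $v(a)=(a-\tau)_+$, $a\in\mathbb{R}_+$, for some $\tau\in\overline{\mathbb{R}}_+$.
   Context: $\mathbb{R}_+=[0,\infty)$, $\overline{\mathbb{R}}_+=[0,\infty]$, $(x-\infty)_+=0$, and $K$ is a (nonempty) Polish space. $\mathcal{V}$ is the collection of all increasing (non-decreasing), convex, 1-Lipschitz functions on $\mathbb{R}_+$ that vanish at $0$. $v'_-$ and $v'_+$ denote left- and right-hand derivatives. $\mathcal{M}_1$ is the collection of feasible stop-loss menus: such a menu $M=\{v,d_{(a,k)}\}$ consists of a function $v\in\mathcal{V}$ (the indirect utility function) and deductibles $d_{(a,k)}\in\overline{\mathbb{R}}_+$, $(a,k)\in\mathbb{R}_+\times K$ (the indemnity designed for type $(a,k)$ being $I_{(a,k)}(x)=(x-d_{(a,k)})_+$), satisfying for every $(a,k)\in\mathbb{R}_+\times K$ the incentive compatibility constraint $$v(a')-v(a)\ge (a'-d_{(a,k)})_+-(a-d_{(a,k)})_+\quad\text{for any }a'\in\mathbb{R}_+.$$ *)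

(* Defs.v *)
From HB Require Import structures.
From mathcomp Require Import all_boot all_order all_algebra.
From mathcomp Require Import all_classical all_reals all_analysis.

Set Implicit Arguments.
Unset Strict Implicit.
Unset Printing Implicit Defensive.

Import Order.TTheory GRing.Theory Num.Theory.
Import numFieldNormedType.Exports.
Local Open Scope classical_set_scope.
Local Open Scope ring_scope.

Section Polish.
Context {R : realType} {K : topologicalType}.

Definition is_metric (dist : K -> K -> R) : Prop :=
  [/\ forall x y, 0 <= dist x y,
      forall x y, dist x y = 0 <-> x = y,
      forall x y, dist x y = dist y x &
      forall x y z, dist x z <= dist x y + dist y z].

Definition metrizes (dist : K -> K -> R) : Prop :=
  forall (x : K) (A : set K),
    nbhs x A <-> exists2 e : R, 0 < e & [set y | dist x y < e] `<=` A.

Definition complete_metric (dist : K -> K -> R) : Prop :=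
  forall u : nat -> K,
    (forall e : R, 0 < e -> exists N : nat, forall m n : nat,
       (N <= m)%N -> (N <= n)%N -> dist (u m) (u n) < e) ->
    exists x : K, u @ \oo --> x.

End Polish.

Definition polish_space (R : realType) (K : topologicalType) : Prop :=
  (exists2 D : set K, countable D & dense D) /\
  (exists dist : K -> K -> R,
     [/\ is_metric dist, metrizes dist & complete_metric dist]).

Section Menus.
Context {R : realType}.

(* The truncation in \bar R gives (x - oo)_+ = 0. *)
Definition stop_loss (x : R) (d : \bar R) : R :=
  fine (maxe (x%:E - d) 0)%E.

(* Functions on [0, +oo[ are represented by functions on R whose values at
   negative arguments are arbitrary and never used. *)
Definition indirect_utility_class : set (R -> R) :=
  [set v | [/\ {in `[0, +oo[ &, {homo v : x y / x <= y}},
               convex_function (E := R^o) `[0, +oo[ v,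
               1.-lipschitz_(`[0, +oo[ : set R^o) (v : R^o -> R^o) &
               v 0 = 0]].

(* For a convex v these limits exist at every a > 0, and the Lipschitz
   property makes the right-hand one exist at 0 as well. *)
Definition left_derivative (v : R -> R) (a : R) : R :=
  lim ((fun h : R => h^-1 * (v (a + h) - v a)) @ 0^'-).

Definition right_derivative (v : R -> R) (a : R) : R :=
  lim ((fun h : R => h^-1 * (v (a + h) - v a)) @ 0^'+).

Record menu (K : Type) := Menu {
  indirect_utility : R -> R;
  deductible : R * K -> \bar R
}.

Definition feasible_menu (K : Type) : set (menu K) :=
  [set M | let v := indirect_utility M in let d := deductible M in
    [/\ v \in indirect_utility_class,
        forall (a : R) (k : K), 0 <= a -> (0 <= d (a, k))%E &
        forall (a : R) (k : K), 0 <= a -> forall a' : R, 0 <= a' ->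
          v a' - v a >= stop_loss a' (d (a, k)) - stop_loss a (d (a, k))]].

End Menus.

Arguments menu : clear implicits.

(* Main.v *)
(** Incentive compatibility at a type [a] with deductible [d] leaves two cases:
    if [d <= a], then [v] grows with slope at least, hence (Lipschitz) exactly, 1
    beyond [a]; if [a <= d], then [v] is constant, hence 0, on [[0, a]].  So [v]
    has slope 1 right after it leaves 0, and [tau] is the supremum of its zeros.
    The one-sided derivatives are then read off the explicit form of [v]. *)

Require Import Defs.
From mathcomp Require Import all_boot all_order all_algebra.
From mathcomp Require Import all_classical all_reals all_analysis.
From mathcomp Require Import lra.

Import Order.TTheory GRing.Theory Num.Theory.
Import numFieldNormedType.Exports.
Local Open Scope classical_set_scope.
Local Open Scope ring_scope.

Section StopLoss.
Context {R : realType}.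
Implicit Types (x y t : R) (d : \bar R).

Lemma stop_loss_fin x t : stop_loss x t%:E = Num.max (x - t) 0.
Proof. by rewrite /stop_loss -EFinB -EFin_max. Qed.

Lemma stop_loss_pinfty x : stop_loss x +oo%E = 0.
Proof. by rewrite /stop_loss addeNy max_r ?leNye. Qed.

Lemma stop_loss_eq0 x d : (x%:E <= d)%E -> stop_loss x d = 0.
Proof.
case: d => [t| |] //; last by rewrite stop_loss_pinfty.
by rewrite lee_fin stop_loss_fin => xt; rewrite max_r// subr_le0.
Qed.

(** The sign condition excludes [d = -oo], where [fine] sends the infinite value to 0 and the left
    side would be 0. *)
Lemma stop_lossB d x y : (0 <= d)%E -> (d <= x%:E)%E -> x <= y ->
  stop_loss y d - stop_loss x d = y - x.
Proof.
case: d => [t| |] // _; rewrite lee_fin !stop_loss_fin => tx xy.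
by rewrite !max_l; lra.
Qed.

End StopLoss.

Section LocallyAffine.
Context {R : realType}.
Implicit Types (f : R -> R) (a c e : R).

(** The difference quotient is constant for small [h > 0], so its limit exists and is that
    constant. *)
Lemma right_derivative_affine f a c e : 0 < e ->
  (forall h : R, 0 < h -> h < e -> f (a + h) - f a = c * h) ->
  right_derivative f a = c.
Proof.
move=> e0 fE; apply: cvg_lim => //; apply: cvg_near_cst.
near=> h; have h0 : 0 < h by near: h; exact: nbhs_right_gt.
have he : h < e by near: h; exact: nbhs_right_lt.
by rewrite fE// mulrCA mulVf ?mulr1// gt_eqF.
Unshelve. all: by end_near. Qed.

Lemma left_derivative_affine f a c e : 0 < e ->
  (forall h : R, - e < h -> h < 0 -> f (a + h) - f a = c * h) ->
  left_derivative f a = c.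
Proof.
move=> e0 fE; apply: cvg_lim => //; apply: cvg_near_cst.
near=> h; have h0 : h < 0 by near: h; exact: nbhs_left_lt.
have eh : - e < h by near: h; apply: nbhs_left_gt; rewrite oppr_lt0.
by rewrite fE// mulrCA mulVf ?mulr1// lt_eqF.
Unshelve. all: by end_near. Qed.

End LocallyAffine.

Section StopLossDerivatives.
Context {R : realType}.
Variables (v : R -> R) (tau : \bar R).
Hypotheses (tau0 : (0 <= tau)%E)
  (vE : forall a, 0 <= a -> v a = stop_loss a tau).

(** At the kink [a = tau] the slope to the right is already 1 and the slope to the left still 0:
    hence [<=] here and [<] for the left derivative. *)
Lemma right_derivative_stop_loss (a : R) : 0 <= a ->
  right_derivative v a = (tau <= a%:E)%E%:R.
Proof.
move=> a0; case: leP => [ta|at_] /=.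
  apply: (right_derivative_affine _ _ _ 1) => // h h0 _.
  by rewrite !vE ?stop_lossB//; lra.
have [e e0 ae] : exists2 e : R, 0 < e & ((a + e)%:E <= tau)%E.
  case: tau at_ => [t| |] //=; last by exists 1 => //; rewrite leey.
  by rewrite lte_fin => at_; exists (t - a); rewrite ?lee_fin; lra.
apply: (right_derivative_affine _ _ _ _ e0) => h h0 he.
rewrite !vE ?stop_loss_eq0 ?(ltW at_)//; [lra| |lra].
by apply: le_trans ae; rewrite lee_fin; lra.
Qed.

Lemma left_derivative_stop_loss (a : R) : 0 < a ->
  left_derivative v a = (tau < a%:E)%E%:R.
Proof.
move=> a0; case: ltP => [|at_] /=.
  case: tau tau0 vE => [t| |] //; rewrite lee_fin lte_fin => t0 vtE ta.
  apply: (left_derivative_affine _ _ _ (a - t)); first lra.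
  move=> h eh h0; rewrite !vtE ?stop_loss_fin; [|lra|lra].
  by rewrite !max_l; lra.
(* The radius [a] keeps [a + h] nonnegative, where [vE] applies. *)
apply: (left_derivative_affine _ _ _ _ a0) => h eh h0.
rewrite !vE ?(stop_loss_eq0 a)//; [|lra|lra].
rewrite stop_loss_eq0; first lra.
by apply: le_trans at_; rewrite lee_fin; lra.
Qed.

End StopLossDerivatives.

Section IndirectUtility.
Context {R : realType} {K : Type}.
Variables (v : R -> R) (d : R * K -> \bar R).
Hypothesis M_feasible : feasible_menu (Menu v d).

Lemma indirect_utility0 : v 0 = 0.
Proof. by case: M_feasible => /set_mem[]. Qed.

Lemma indirect_utility_homo (x y : R) : 0 <= x -> x <= y -> v x <= v y.
Proof.
case: M_feasible => /set_mem[vh _ _ _] _ _ x0 xy.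
by apply: vh; rewrite // in_itv/= andbT// (le_trans x0).
Qed.

Lemma indirect_utility_ge0 (x : R) : 0 <= x -> 0 <= v x.
Proof. by move=> x0; rewrite -indirect_utility0 indirect_utility_homo. Qed.

Lemma indirect_utility_lip (x y : R) : 0 <= x -> x <= y -> v y - v x <= y - x.
Proof.
case: M_feasible => /set_mem[_ _ vl _] _ _ x0 xy.
have /= := vl (y, x); rewrite mul1r !in_itv/= !andbT.
rewrite (ger0_norm (_ : 0 <= y - x)) ?subr_ge0// => /(_ _)/(le_trans (ler_norm _)).
by apply; split => //; exact: le_trans xy.
Qed.

(** The Lipschitz bound gives one inequality, incentive compatibility at [a' = b] the other. *)
Lemma indirect_utility_slope1 (a b : R) (k : K) : 0 <= a -> a <= b ->
  (d (a, k) <= a%:E)%E -> v b - v a = b - a.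
Proof.
move=> a0 ab da; apply/eqP; rewrite eq_le indirect_utility_lip//=.
case: M_feasible => _ d0 IC.
by rewrite -(stop_lossB _ _ _ (d0 a k a0) da ab) IC// (le_trans a0).
Qed.

(** Incentive compatibility at [a' = 0], where both indemnities vanish, gives [v a <= v 0]. *)
Lemma indirect_utility_eq0 (a : R) (k : K) : 0 <= a ->
  (a%:E <= d (a, k))%E -> v a = 0.
Proof.
move=> a0 ad; apply/eqP; rewrite eq_le indirect_utility_ge0// andbT.
case: M_feasible => _ d0 /(_ a k a0 0 (lexx _)) /=.
by rewrite !stop_loss_eq0 ?d0// indirect_utility0; lra.
Qed.

Lemma indirect_utility_stop_loss : [set: K] !=set0 ->
  exists2 tau : \bar R, (0 <= tau)%E &
    forall a : R, 0 <= a -> v a = stop_loss a tau.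
Proof.
move=> [k _].
(* If [v] vanishes identically, its zeros are unbounded and [tau] is [+oo]. Otherwise, by
   monotonicity, a point [b] with [v b] nonzero bounds them. *)
have [v0|/existsNP[b /not_implyP[b0 /eqP vb]]] :=
    pselect (forall a, 0 <= a -> v a = 0).
  by exists +oo%E => // a a0; rewrite stop_loss_pinfty v0.
pose Z := [set a : R | 0 <= a /\ v a = 0].
have Z0 : Z 0 by split => //; exact: indirect_utility0.
have Zb : ubound Z b.
  move=> z [z0 vz]; rewrite leNgt; apply/negP => bz; move/eqP: vb; apply.
  apply/eqP; rewrite eq_le indirect_utility_ge0// andbT -vz.
  by rewrite indirect_utility_homo// ltW.
have supZ : has_sup Z by split; [exists 0 | exists b].
have t0 : 0 <= sup Z by apply: ub_le_sup => //; exists b.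
have vt (a : R) : sup Z < a -> v a = a - sup Z.
  move=> ta; have a0 : 0 <= a by exact: le_trans (ltW ta).
  apply/eqP; rewrite eq_le; apply/andP; split.
    (* A zero [z > sup Z - e] and the Lipschitz bound give [v a <= a - z]. *)
    apply/ler_addgt0Pr => e e0.
    have [z [z0 vz] zt] := sup_adherent e0 supZ.
    have za : z <= a.
      by apply: le_trans (ltW ta); apply: ub_le_sup => //; exists b.
    by have := indirect_utility_lip z a z0 za; lra.
  rewrite leNgt; apply/negP => va.
  (* The slope is 1 beyond every [c > sup Z], too much rise if [c < a - v a]. *)
  pose c := (sup Z + (a - v a)) / 2.
  have va0 := indirect_utility_ge0 a a0.
  have tc : sup Z < c by rewrite /c; lra.
  have ca : c < a - v a by rewrite /c; lra.
  have c0 : 0 <= c by exact: le_trans (ltW tc).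
  have [dc|/ltW cd] := leP (d (c, k)) c%:E.
    have ca' : c <= a by lra.
    have := indirect_utility_slope1 c a k c0 ca' dc.
    by have := indirect_utility_ge0 c c0; lra.
  (* With its deductible above [c], the point [c] would be a zero beyond [sup Z]. *)
  have : c <= sup Z.
    apply: ub_le_sup; first by exists b.
    by split => //; exact: indirect_utility_eq0 cd.
  by rewrite leNgt tc.
exists (sup Z)%:E; first by rewrite lee_fin.
move=> a a0; rewrite stop_loss_fin.
have [ta|at_] := ltP (sup Z) a; first by rewrite vt// max_l//; lra.
rewrite max_r; last by lra.
apply/eqP; rewrite eq_le indirect_utility_ge0// andbT.
(* Monotonicity and the formula beyond [sup Z] give [v a <= v (sup Z + e) = e], without first
   knowing that [sup Z] is a zero. *)
apply/ler_addgt0Pr => e e0.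
have te : sup Z < sup Z + e by lra.
apply: (le_trans (indirect_utility_homo a (sup Z + e) a0 _)); first lra.
by rewrite vt//; lra.
Qed.

End IndirectUtility.

Theorem lemma5p1 (R : realType) (K : topologicalType)
    (K_polish : polish_space R K) (K_nonempty : [set: K] !=set0)
    (v : R -> R) (d : R * K -> \bar R)
    (M_feasible : feasible_menu (Menu v d)) :
  (forall k : K,
     (forall a : R, 0 < a ->
        [/\ left_derivative v a <= (d (a, k) < a%:E)%E%:R,
            (d (a, k) < a%:E)%E%:R <= (d (a, k) <= a%:E)%E%:R :> R &
            (d (a, k) <= a%:E)%E%:R <= right_derivative v a]) /\
     (d (0%R, k) <= 0)%E%:R <= right_derivative v 0) /\
  (exists2 tau : \bar R, (0 <= tau)%E &
     forall a : R, 0 <= a -> v a = stop_loss a tau).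
Proof.
(* Part (ii) comes first: it turns (i) into a comparison of indicators, settled by [tau_le] and
   [le_tau]. *)
have [tau tau0 vE] := indirect_utility_stop_loss v d M_feasible K_nonempty.
split; last by exists tau.
(* Were [a < tau], [v] would be flat on some [[a, b]], where it must have slope 1. *)
have tau_le (a : R) (k : K) : 0 <= a -> (d (a, k) <= a%:E)%E ->
    (tau <= a%:E)%E.
  move=> a0 da; rewrite leNgt; apply/negP => at_.
  have [b ab bt] : exists2 b : R, a < b & (b%:E <= tau)%E.
    case: tau {tau0 vE} at_ => [t| |] //; first by exists t.
    by exists (a + 1); rewrite ?leey//; lra.
  have := indirect_utility_slope1 v d M_feasible a b k a0 (ltW ab) da.
  by rewrite !vE ?stop_loss_eq0 ?(ltW at_)//; lra.
(* Were [tau < a], [v a = a - tau] would be positive. *)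
have le_tau (a : R) (k : K) : 0 <= a -> (a%:E <= d (a, k))%E ->
    (a%:E <= tau)%E.
  move=> a0 /(indirect_utility_eq0 v d M_feasible a k a0).
  rewrite vE// leNgt => sl0; apply/negP => ta.
  case: tau tau0 ta sl0 {vE tau_le} => [t| |] //= _.
  by rewrite lte_fin stop_loss_fin => ta; rewrite max_l; lra.
have le_rd (a : R) (k : K) : 0 <= a ->
    (d (a, k) <= a%:E)%E%:R <= right_derivative v a.
  move=> a0; rewrite (right_derivative_stop_loss v tau)// ler_nat.
  by case: leP => // /(tau_le a k a0) ->.
move=> k; split=> [a a0|]; last exact: le_rd.
have a0' := ltW a0; split; last exact: le_rd.
- rewrite (left_derivative_stop_loss v tau)// ler_nat.
  by case: (ltP (d _)) => [_|/(le_tau a k a0')]; [exact: leq_b1|case: ltP].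
- by rewrite ler_nat; case: ltP => // /ltW ->.
Qed.
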